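(* Let $n\ge p\ge 1$ be such that $\dim St(n,p)\ge 2$. The sectional curvature $K^{St}_c$ of the Stiefel manifold $St(n,p)$ under the canonical metric is globally bounded by $$0\le K^{St}_c(X,Y)\le \tfrac54$$ for all orthonormal pairs $X,Y$ of tangent vectors. Moreover: 1. For $p\ge 2$, $n\ge p+2$, the upper bound $\frac54$ is sharp (attained). Up to trace-preserving transformations, the maximum curvature is attained only for the tangent plane spanned by $$X=\begin{pmatrix}0&-B_1^T\\ B_1&0\end{pmatrix},\qquad Y=\begin{pmatrix}0&-B_2^T\\ B_2&0\end{pmatrix},$$ where $B_1,B_2\in\mathbb{R}^{(n-p)\times p}$ are $$B_1=\pm\frac1{\sqrt2}\begin{pmatrix}\begin{matrix}0&1\\ -1&0\end{matrix}&\mathbf 0\\ \mathbf 0&\mathbf 0\end{pmatrix},\qquad B_2=\pm\frac1{\sqrt2}\begin{pmatrix}\begin{matrix}1&0\\ 0&1\end{matrix}&\mathbf 0\\ \mathbf 0&\mathbf 0\end{pmatrix}.$$ 2. If $\operatorname{rank}(B_1)=1$ or $\operatorname{rank}(B_2)=1$ holds for the $B$-blocks in $X$ or $Y$, respectively, then $K^{St}_c(X,Y)\le 1$. The bound is attained (when $p\ge2$, $n\ge p+2$, so that the following matrices fit dimension-wise) for $X,Y$ with zero $A$-blocks and $$B_1=\pm\begin{pmatrix}\begin{matrix}0&0\\ 1&0\end{matrix}&\mathbf 0\\ \mathbf 0&\mathbf 0\end{pmatrix},\qquad B_2=\pm\begin{pmatrix}\begin{matrix}1&0\\ 0&0\end{matrix}&\mathbf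 0\\ \mathbf 0&\mathbf 0\end{pmatrix}.$$ 3. For $p=1$ and $n\ge 3$, $K^{St}_c(X,Y)\le 1$ and the bound is sharp. It is attained for the matrices $B_1,B_2$ of item 2 reduced to their first column, i.e. $B_1=\pm(0,1,0,\dots,0)^T$, $B_2=\pm(1,0,\dots,0)^T\in\mathbb{R}^{n-1}$. 4. For $(n,p)=(3,2)$ or $(n,p)=(3,3)$, the sectional curvature has the constant value $K^{St}_c(X,Y)\equiv\frac14$. 5. For $n\ge4$ and $p=n-1$ or $p=n$, $K^{St}_c(X,Y)\le\frac12$ and the bound is sharp.
   Context: $St(n,p)=\{U\in\mathbb{R}^{n\times p}\mid U^TU=I_p\}$, realized as the quotient $SO(n)/SO(n-p)$ (for $p=n$ this is read as $SO(n)$). $SO(n)$ carries the bi-invariant metric $\langle X,Y\rangle_Q=\frac12\operatorname{tr}(X^TY)$; the canonical metric on $St(n,p)$ is the induced quotient metric. The tangent space at $[I]$ is identified with the horizontal space $$\left\{\begin{pmatrix}A&-B^T\\ B&0\end{pmatrix}\;\middle|\;A\in\mathbb{R}^{p\times p},\ A^T=-A,\ B\in\mathbb{R}^{(n-p)\times p}\right\},$$ with inner product $\frac12\operatorname{tr}(X^TY)$; since the metric is $SO(n)$-invariant, it suffices to consider tangent planes at $[I]$. For $p=n$ the $B$-blocks are empty. Tangent vectors $X=\begin{pmatrix}A_1&-B_1^T\\ B_1&0\end{pmatrix}$ and $Y=\begin{pmatrix}A_2&-B_2^T\\ B_2&0\end{pmatrix}$ are orthonormal iff $\frac12\|A_j\|_F^2+\|B_j\|_F^2=1$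 for $j=1,2$ and $\frac12\operatorname{tr}(A_1^TA_2)+\operatorname{tr}(B_1^TB_2)=0$. For such an orthonormal pair the sectional curvature of the plane spanned by $X,Y$ is $$K^{St}_c(X,Y)=\tfrac12\|B_2B_1^T-B_1B_2^T\|_F^2+\tfrac14\|B_1A_2-B_2A_1\|_F^2+\tfrac18\|[A_1,A_2]-(B_1^TB_2-B_2^TB_1)\|_F^2,$$ where $[A_1,A_2]=A_1A_2-A_2A_1$ and $\|\cdot\|_F$ is the Frobenius norm. All curvature statements refer to orthonormal pairs $X,Y$. A trace-preserving transformation is a simultaneous change of coordinates $(B_1,B_2)\mapsto(U^TB_1V,\,U^TB_2V)$ with orthogonal matrices $U\in O(n-p)$, $V\in O(p)$. In matrices written with $\mathbf 0$-blocks, the displayed $2\times2$ block is the upper-left block and all remaining entries are zero. A bound is called sharp if it is attained by some tangent plane. *)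

(* Defs.v *)
From HB Require Import structures.
From mathcomp Require Import all_boot all_order all_algebra.
From mathcomp Require Import reals.

Set Implicit Arguments.
Unset Strict Implicit.
Unset Printing Implicit Defensive.

Import Order.TTheory GRing.Theory Num.Theory.
Local Open Scope ring_scope.

Section Stiefel.
Variable R : realType.

(* The ambient n x n matrices are typed 'M_(p + (n - p)) so that they carry
   the block decomposition; this is the intended size exactly when p <= n. *)
Definition horizontal (n p : nat) (A : 'M[R]_p) (B : 'M[R]_(n - p, p)) :
  'M[R]_(p + (n - p)) := block_mx A (- B^T) B 0.

Definition Ablock (n p : nat) (X : 'M[R]_(p + (n - p))) : 'M[R]_p :=
  ulsubmx X.

Definition Bblock (n p : nat) (X : 'M[R]_(p + (n - p))) : 'M[R]_(n - p, p) :=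
  dlsubmx X.

(* Maps X to the horizontal matrix with blocks A - A^T and B, where A and B are
   the left blocks of X; its image is the horizontal space. *)
Definition horizontalize (n p : nat) (X : 'M[R]_(p + (n - p))) :
  'M[R]_(p + (n - p)) :=
  horizontal (Ablock X - (Ablock X)^T) (Bblock X).

Fact horizontalize_is_linear (n p : nat) : linear (@horizontalize n p).
Proof.
move=> c X Y; rewrite /horizontalize /horizontal /Ablock /Bblock.
rewrite scale_block_mx add_block_mx scaler0 addr0.
by congr block_mx; apply/matrixP=> i j;
  rewrite !mxE ?mulrBr ?opprD ?mulrN // addrACA.
Qed.

HB.instance Definition _ (n p : nat) :=
  GRing.isLinear.Build R 'M[R]_(p + (n - p)) 'M[R]_(p + (n - p)) _
    (@horizontalize n p) (@horizontalize_is_linear n p).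

Definition tangent_space (n p : nat) : {vspace 'M[R]_(p + (n - p))} :=
  limg (linfun (@horizontalize n p)).

Lemma tangent_spaceP (n p : nat) (X : 'M[R]_(p + (n - p))) :
  reflect (exists A B, A^T = - A /\ X = horizontal A B)
          (X \in tangent_space n p).
Proof.
apply: (iffP memv_imgP) => [[Z _ ->]|[A [B [skA ->]]]].
  rewrite lfunE; exists (Ablock Z - (Ablock Z)^T), (Bblock Z); split=> //.
  by rewrite linearB /= trmxK opprB.
exists (horizontal (2^-1 *: A) B); first exact: memvf.
rewrite lfunE /= /horizontalize /Ablock /Bblock block_mxKul block_mxKdl.
by rewrite linearZ /= skA scalerN opprK -scalerDl -[2^-1]mul1r -splitr scale1r.
Qed.

Definition dimSt (n p : nat) : nat := \dim (tangent_space n p).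

Definition dotQ (N : nat) (X Y : 'M[R]_N) : R := 2^-1 * \tr (X^T *m Y).

(* Orthonormal pairs of tangent vectors at the base point of St(n, p). *)
Definition orthonormal_pair (n p : nat) (X Y : 'M[R]_(p + (n - p))) : Prop :=
  [/\ X \in tangent_space n p, Y \in tangent_space n p,
      dotQ X X = 1, dotQ Y Y = 1 & dotQ X Y = 0].

Definition normF (m q : nat) (M : 'M[R]_(m, q)) : R :=
  Num.sqrt (\sum_i \sum_j M i j ^+ 2).

(* The sectional curvature of the plane spanned by an orthonormal pair; the
   formula is not normalized, so it has this meaning for such pairs only. *)
Definition seccurv (n p : nat) (X Y : 'M[R]_(p + (n - p))) : R :=
  let A1 := Ablock X in let B1 := Bblock X in
  let A2 := Ablock Y in let B2 := Bblock Y in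
  2^-1 * normF (B2 *m B1^T - B1 *m B2^T) ^+ 2
  + 4^-1 * normF (B1 *m A2 - B2 *m A1) ^+ 2
  + 8^-1 * normF ((A1 *m A2 - A2 *m A1)
                  - (B1^T *m B2 - B2^T *m B1)) ^+ 2.

Definition orthogonal_mx (m : nat) (U : 'M[R]_m) : Prop := U^T *m U = 1%:M.

(* The m x q matrix with upper-left block [a b; c d] and zeros elsewhere,
   truncated if m < 2 or q < 2. *)
Definition corner_mx (m q : nat) (a b c d : R) : 'M[R]_(m, q) :=
  \matrix_(i, j)
    match nat_of_ord i, nat_of_ord j with
    | 0%N, 0%N => a
    | 0%N, 1%N => b
    | 1%N, 0%N => c
    | 1%N, 1%N => d
    | _, _ => 0
    end.

(* In the four families below, the boolean s selects the sign (-1) ^+ s. *)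
Definition B1max (m q : nat) (s : bool) : 'M[R]_(m, q) :=
  ((-1) ^+ s / Num.sqrt 2) *: corner_mx m q 0 1 (-1) 0.

Definition B2max (m q : nat) (s : bool) : 'M[R]_(m, q) :=
  ((-1) ^+ s / Num.sqrt 2) *: corner_mx m q 1 0 0 1.

Definition B1rk1 (m q : nat) (s : bool) : 'M[R]_(m, q) :=
  (-1) ^+ s *: corner_mx m q 0 0 1 0.

Definition B2rk1 (m q : nat) (s : bool) : 'M[R]_(m, q) :=
  (-1) ^+ s *: corner_mx m q 1 0 0 0.

End Stiefel.

(* Main.v *)
Require Import Defs.
From mathcomp Require Import all_boot all_order all_algebra.
From mathcomp Require Import reals.
From mathcomp Require Import complex ring lra.
Import Order.TTheory GRing.Theory Num.Theory.
Local Open Scope ring_scope.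

(* With |.| the Frobenius norm, the curvature of an orthonormal pair is
   K = 1/8 |[X,Y]|^2 + 3/8 |M|^2, where M = B2 B1^T - B1 B2^T.
   For a skew matrix S one has 2 |S C|^2 <= |S|^2 |C|^2. Combined with
   |M|^2 = 2 <M B1, B2> this gives |M|^2 <= 2 |B1|^2 |B2|^2 <= 2. It also gives
   |[X,Y]| <= |X| |Y| for skew X, Y, by induction on the size: a complex
   eigenvector of X makes X = diag(P, X') in a real orthonormal basis, and an
   off-diagonal block C of Y contributes
   2 |X'C - CP|^2 <= 4 (|X'C|^2 + |CP|^2) <= 2 |X|^2 |C|^2.
   As |X|^2 = |Y|^2 = 2, K <= 1/2 + 3/4.
   If K = 5/4 then |B1| = |B2| = 1 and A1 = A2 = 0, and both M and
   N = B1^T B2 - B2^T B1 have the extremal norm; then M = w c^T - c w^T for an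
   orthonormal pair c, w, B2 = M B1 and B1 = - M B2, and |N|^2 = 2 forces the
   vectors sqrt 2 B1^T c and sqrt 2 B1^T w to be orthonormal.
   If B1 = u v^T with |u| = 1, splitting off the component of B2 along u leaves
   the curvature of a problem with one-row B-blocks (where M = 0) plus two
   terms that are bounded directly. *)

Set Implicit Arguments.
Unset Strict Implicit.
Unset Printing Implicit Defensive.

(** * The Frobenius inner product on real matrices *)

Section InnerProduct.
Variable R : rcfType.
Implicit Types m n q : nat.

Definition ip m n (A B : 'M[R]_(m, n)) : R := \tr (A^T *m B).
Definition sq m n (A : 'M[R]_(m, n)) : R := ip A A.

Lemma ipE m n (A B : 'M[R]_(m, n)) : ip A B = \sum_i \sum_j A i j * B i j.
Proof.
rewrite /ip /mxtrace exchange_big; apply: eq_bigr => j _.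
by rewrite mxE; apply: eq_bigr => i _; rewrite mxE.
Qed.

Lemma ipC m n (A B : 'M[R]_(m, n)) : ip A B = ip B A.
Proof. by rewrite /ip -mxtrace_tr trmx_mul trmxK. Qed.

Lemma ipDr m n (A B C : 'M[R]_(m, n)) : ip A (B + C) = ip A B + ip A C.
Proof. by rewrite /ip mulmxDr mxtraceD. Qed.

Lemma ipZr m n a (A B : 'M[R]_(m, n)) : ip A (a *: B) = a * ip A B.
Proof. by rewrite /ip -scalemxAr mxtraceZ. Qed.

Lemma ipNr m n (A B : 'M[R]_(m, n)) : ip A (- B) = - ip A B.
Proof. by rewrite -scaleN1r ipZr mulN1r. Qed.

Lemma ipDl m n (A B C : 'M[R]_(m, n)) : ip (A + B) C = ip A C + ip B C.
Proof. by rewrite !(ipC _ C) ipDr. Qed.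

Lemma ipZl m n a (A B : 'M[R]_(m, n)) : ip (a *: A) B = a * ip A B.
Proof. by rewrite !(ipC _ B) ipZr. Qed.

Lemma ipNl m n (A B : 'M[R]_(m, n)) : ip (- A) B = - ip A B.
Proof. by rewrite !(ipC _ B) ipNr. Qed.

Definition ipL := (ipDl, ipDr, ipNl, ipNr, ipZl, ipZr).

Lemma ip0r m n (A : 'M[R]_(m, n)) : ip A 0 = 0.
Proof. by rewrite -(scale0r A) ipZr mul0r. Qed.

Lemma ip_tr m n (A B : 'M[R]_(m, n)) : ip A^T B^T = ip A B.
Proof. by rewrite /ip trmxK mxtrace_mulC -mxtrace_tr trmx_mul trmxK. Qed.

Lemma ip_mulLl m n q (X : 'M[R]_(m, q)) (A : 'M_(q, n)) (B : 'M_(m, n)) :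
  ip (X *m A) B = ip A (X^T *m B).
Proof. by rewrite /ip trmx_mul mulmxA. Qed.

Lemma ip_mulRl m n q (X : 'M[R]_(q, n)) (A : 'M_(m, q)) (B : 'M_(m, n)) :
  ip (A *m X) B = ip A (B *m X^T).
Proof. by rewrite -ip_tr trmx_mul ip_mulLl -ip_tr trmxK trmx_mul !trmxK. Qed.

Lemma tr_mul_vec n (u v : 'cV[R]_n) : u^T *m v = (ip u v)%:M.
Proof. by rewrite [LHS]mx11_scalar /ip trace_mx11. Qed.

Lemma outer_mul m n (u : 'cV[R]_m) (v w : 'cV[R]_n) :
  u *m v^T *m w = ip v w *: u.
Proof. by rewrite -mulmxA tr_mul_vec mul_mx_scalar. Qed.

Lemma ip_outer m n (u x : 'cV[R]_m) (v y : 'cV[R]_n) :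
  ip (u *m v^T) (x *m y^T) = ip u x * ip v y.
Proof. by rewrite ip_mulRl trmxK outer_mul ipZr mulrC ipC (ipC y). Qed.

Lemma ip_outerr m n (A : 'M[R]_(m, n)) (x : 'cV[R]_m) (y : 'cV[R]_n) :
  ip A (x *m y^T) = ip (A *m y) x.
Proof. by rewrite ipC ip_mulRl trmxK ipC. Qed.

Lemma sqE m n (A : 'M[R]_(m, n)) : sq A = \sum_i \sum_j A i j ^+ 2.
Proof. by rewrite /sq ipE; under eq_bigr do under eq_bigr do rewrite -expr2. Qed.

Lemma sq_ge0 m n (A : 'M[R]_(m, n)) : 0 <= sq A.
Proof.
by rewrite sqE; apply: sumr_ge0 => i _; apply: sumr_ge0 => j _; apply: sqr_ge0.
Qed.

Lemma sq_eq0 m n (A : 'M[R]_(m, n)) : sq A = 0 -> A = 0.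
Proof.
rewrite sqE => /eqP; rewrite psumr_eq0 => [/allP A0|i _]; last first.
  by apply: sumr_ge0 => j _; apply: sqr_ge0.
apply/matrixP => i j; rewrite mxE.
have := A0 i; rewrite mem_index_enum => /(_ isT) /=.
rewrite psumr_eq0 => [/allP /(_ j)|k _]; last exact: sqr_ge0.
by rewrite mem_index_enum => /(_ isT) /=; rewrite sqrf_eq0 => /eqP.
Qed.

Lemma sq_gt0 m n (A : 'M[R]_(m, n)) : A != 0 -> 0 < sq A.
Proof.
by move=> A0; rewrite lt_neqAle sq_ge0 andbT eq_sym; apply: contra_neq A0 => /sq_eq0.
Qed.

Lemma sq0 m n : sq (0 : 'M[R]_(m, n)) = 0.
Proof. exact: ip0r. Qed.

Lemma sqN m n (A : 'M[R]_(m, n)) : sq (- A) = sq A.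
Proof. by rewrite /sq ipNl ipNr opprK. Qed.

Lemma sqZ m n a (A : 'M[R]_(m, n)) : sq (a *: A) = a ^+ 2 * sq A.
Proof. by rewrite /sq ipZl ipZr mulrA. Qed.

Lemma sq_tr m n (A : 'M[R]_(m, n)) : sq A^T = sq A.
Proof. exact: ip_tr. Qed.

Lemma sqB m n (A B : 'M[R]_(m, n)) : sq (A - B) = sq A - 2 * ip A B + sq B.
Proof. by rewrite /sq !ipL (ipC B A); ring. Qed.

Lemma sqB_le m n (A B : 'M[R]_(m, n)) : sq (A - B) <= 2 * (sq A + sq B).
Proof.
by have := sq_ge0 (A - - B); rewrite !sqB sqN ipNr; nra.
Qed.

Lemma cauchy_schwarz m n (A B : 'M[R]_(m, n)) : ip A B ^+ 2 <= sq A * sq B.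
Proof.
have [B0|B0] := eqVneq (sq B) 0.
  by rewrite (sq_eq0 B0) ip0r expr0n mulr_ge0 ?sq_ge0.
have B_gt0 : 0 < sq B by rewrite lt_neqAle eq_sym B0 sq_ge0.
have := sq_ge0 (sq B *: A - ip A B *: B).
rewrite sqB !sqZ ipZl ipZr.
have -> : sq B ^+ 2 * sq A - 2 * (sq B * (ip A B * ip A B)) + ip A B ^+ 2 * sq B
  = sq B * (sq A * sq B - ip A B ^+ 2) by ring.
by rewrite pmulr_rge0 // subr_ge0.
Qed.

Lemma sq_col m n (A : 'M[R]_(m, n)) : sq A = \sum_j sq (col j A).
Proof.
rewrite sqE exchange_big; apply: eq_bigr => j _; rewrite sqE.
by apply: eq_bigr => i _; rewrite big_ord1 mxE.
Qed.

Lemma col_mulmx m n q (A : 'M[R]_(m, n)) (B : 'M[R]_(n, q)) j :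
  col j (A *m B) = A *m col j B.
Proof. by rewrite !colE mulmxA. Qed.

Lemma ip_block m1 m2 n1 n2 (A A' : 'M[R]_(m1, n1)) (B B' : 'M_(m1, n2))
  (C C' : 'M_(m2, n1)) (D D' : 'M_(m2, n2)) :
  ip (block_mx A B C D) (block_mx A' B' C' D')
  = ip A A' + ip B B' + ip C C' + ip D D'.
Proof.
by rewrite /ip tr_block_mx mulmx_block mxtrace_block !mxtraceD; ring.
Qed.

End InnerProduct.

(** * Norm estimates for products with skew matrices *)

Section SkewMatrices.
Variable R : rcfType.
Implicit Types m n q : nat.

Lemma ip_skew n (X : 'M[R]_n) (c : 'cV_n) : X^T = - X -> ip (X *m c) c = 0.
Proof.
by move=> skX; have := ip_mulLl X c c; rewrite skX mulNmx ipNr (ipC c) => h; lra.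
Qed.

Lemma sq_wedge n (w c : 'cV[R]_n) :
  sq (w *m c^T - c *m w^T) = 2 * (sq w * sq c - ip w c ^+ 2).
Proof. by rewrite sqB /sq !ip_outer (ipC c w); ring. Qed.

(** For a unit vector [c] the wedge is the orthogonal projection of [X] onto the matrices v c^T - c
    v^T with v orthogonal to [c]. Nonnegativity of this squared distance yields the norm bound
    below, and its vanishing the equality case. *)
Lemma sq_skew_sub_wedge n (X : 'M[R]_n) (c : 'cV_n) : X^T = - X ->
  let w := X *m c in
  sq (sq c *: X - (w *m c^T - c *m w^T))
  = sq c * (sq c * sq X - 2 * sq w).
Proof.
move=> skX w; have wc : ip w c = 0 by exact: ip_skew.
rewrite sqB sqZ sq_wedge wc !ipL !ip_outerr -/w.
have -> : ip (X *m w) c = - sq w by rewrite ip_mulLl skX mulNmx ipNr.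
by rewrite -/(sq w); ring.
Qed.

(** Skewness gains a factor 2 over the general bound, in accordance with the nonzero singular values
    of [X] occurring in pairs. *)
Lemma sq_skew_mulmx_vec n (X : 'M[R]_n) (c : 'cV_n) : X^T = - X ->
  2 * sq (X *m c) <= sq X * sq c.
Proof.
move=> skX; have [->|/sq_gt0 c0] := eqVneq c 0; first by rewrite mulmx0 sq0; lra.
have := sq_ge0 (sq c *: X - ((X *m c) *m c^T - c *m (X *m c)^T)).
by rewrite sq_skew_sub_wedge // pmulr_rge0 // subr_ge0 (mulrC (sq X)).
Qed.

Lemma sq_skew_mulmx_eq n (X : 'M[R]_n) (c : 'cV_n) : X^T = - X ->
  sq c = 1 -> sq X = 2 * sq (X *m c) ->
  X = (X *m c) *m c^T - c *m (X *m c)^T.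
Proof.
move=> skX c1 eqX; apply/eqP; rewrite -subr_eq0; apply/eqP/sq_eq0.
by have := sq_skew_sub_wedge c skX; rewrite c1 scale1r eqX => ->; ring.
Qed.

Lemma sq_skew_mulmx n q (X : 'M[R]_n) (C : 'M_(n, q)) : X^T = - X ->
  2 * sq (X *m C) <= sq X * sq C.
Proof.
move=> skX; rewrite (sq_col C) (sq_col (X *m C)) !mulr_sumr; apply: ler_sum => j _.
by rewrite col_mulmx sq_skew_mulmx_vec.
Qed.

Lemma sq_mulmx_skew n q (X : 'M[R]_n) (C : 'M_(q, n)) : X^T = - X ->
  2 * sq (C *m X) <= sq X * sq C.
Proof.
move=> skX; rewrite -sq_tr trmx_mul -(sq_tr C) skX mulNmx sqN.
exact: sq_skew_mulmx.
Qed.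

(** The matrix [M] of the overview: the lower-right block of the commutator of two horizontal
    matrices. *)
Definition altprod m q (B1 B2 : 'M[R]_(m, q)) : 'M[R]_m :=
  B2 *m B1^T - B1 *m B2^T.

Lemma altprod_skew m q (B1 B2 : 'M[R]_(m, q)) :
  (altprod B1 B2)^T = - altprod B1 B2.
Proof. by rewrite linearB /= !trmx_mul !trmxK opprB. Qed.

Lemma altprodC m q (B1 B2 : 'M[R]_(m, q)) : altprod B2 B1 = - altprod B1 B2.
Proof. by rewrite /altprod opprB. Qed.

(** Both terms of [M] contribute equally, since skewness turns <M B2, B1> into - <M B1, B2>. *)
Lemma sq_altprod m q (B1 B2 : 'M[R]_(m, q)) :
  sq (altprod B1 B2) = 2 * ip (altprod B1 B2 *m B1) B2.
Proof.
set M := altprod B1 B2; have skM : M^T = - M by exact: altprod_skew.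
rewrite /sq {2}/M /altprod ipDr ipNr -!ip_mulRl.
by rewrite (ip_mulLl M B2) skM mulNmx ipNr (ipC B2); ring.
Qed.

(** Put t = <M B1, B2>, so that |M|^2 = 2 t. Cauchy-Schwarz and the skew bound give t^2 <= |M B1|^2
    |B2|^2 <= t |B1|^2 |B2|^2, and a positive t cancels. *)
Lemma sq_altprod_le m q (B1 B2 : 'M[R]_(m, q)) :
  sq (altprod B1 B2) <= 2 * (sq B1 * sq B2).
Proof.
set M := altprod B1 B2; have skM : M^T = - M by exact: altprod_skew.
have := cauchy_schwarz (M *m B1) B2; have := sq_skew_mulmx B1 skM.
have := sq_altprod B1 B2; rewrite -/M => ->.
have := sq_ge0 M; rewrite {1}sq_altprod -/M.
set t := ip _ _; have := sq_ge0 B2; have := sq_ge0 B1.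
set a := sq B1; set b := sq B2 => a0 b0 t0 h1 h2.
have [->|t_neq0] := eqVneq t 0; first by have := mulr_ge0 a0 b0; lra.
have t_gt0 : 0 < t by rewrite lt_neqAle eq_sym t_neq0; lra.
have : t * t <= t * (a * b).
  have := ler_wpM2r b0 h1; rewrite -expr2; move: h2; set z := sq _; lra.
by rewrite ler_pM2l //; lra.
Qed.

(** Here <M B1, B2> = 1 and |M B1| <= 1, so |M B1 - B2|^2 <= 1 - 2 + 1 = 0. Exchanging the arguments
    negates [M] and gives the second equation. *)
Lemma altprod_extremal m q (B1 B2 : 'M[R]_(m, q)) :
  sq B1 = 1 -> sq B2 = 1 -> sq (altprod B1 B2) = 2 ->
  B2 = altprod B1 B2 *m B1 /\ B1 = - (altprod B1 B2 *m B2).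
Proof.
suff H C1 C2 : sq C1 = 1 -> sq C2 = 1 -> sq (altprod C1 C2) = 2 ->
    C2 = altprod C1 C2 *m C1 :> 'M[R]_(m, q).
  move=> b1 b2 M2; split; first exact: H.
  by rewrite -mulNmx -altprodC; apply: H => //; rewrite altprodC sqN.
set M := altprod C1 C2 => c1 c2 M2.
have skM : M^T = - M by exact: altprod_skew.
have := sq_skew_mulmx C1 skM; have := sq_altprod C1 C2.
rewrite -/M c1 M2 => t1 z1; apply/eqP; rewrite eq_sym -subr_eq0.
apply/eqP/sq_eq0/le_anti; rewrite sq_ge0 andbT sqB c2; lra.
Qed.

End SkewMatrices.

(** * Orthogonal matrices that move prescribed vectors *)

Section Orthogonal.
Variable R : rcfType.
Implicit Types m n q : nat.

(** The reflection in the hyperplane orthogonal to [x - y]. The last clause says that it fixes this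
    hyperplane, which allows a second reflection to be composed without spoiling the first. For
    [x = y] the formula degenerates to the identity. *)
Lemma householder n (x y : 'cV[R]_n) : sq x = sq y ->
  exists H : 'M[R]_n, [/\ H^T = H, H *m H = 1%:M, H *m x = y &
    forall z : 'cV_n, ip z x = ip z y -> H *m z = z].
Proof.
move=> xy; set w := x - y; exists (1%:M - (2 / sq w) *: (w *m w^T)).
have Hz (z : 'cV_n) : (1%:M - (2 / sq w) *: (w *m w^T)) *m z
    = z - (2 / sq w * ip w z) *: w.
  by rewrite mulmxBl mul1mx -scalemxAl outer_mul scalerA.
split.
- by rewrite linearB /= trmx1 linearZ /= trmx_mul trmxK.
- rewrite mulmxBr mulmx1 -scalemxAr mulmxA Hz -/(sq w).
  have [w0|/sq_gt0 w0] := eqVneq w 0.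
    by rewrite w0 trmx0 !mulmx0 scaler0 !subr0.
  have -> : w - (2 / sq w * sq w) *: w = - w.
    by rewrite divfK ?gt_eqF // scaler_nat mulr2n opprD addrA subrr sub0r.
  by rewrite mulNmx scalerN opprK subrK.
- rewrite Hz; have [w0|/sq_gt0 w0] := eqVneq w 0.
    by rewrite w0 scaler0 subr0; apply/eqP; rewrite -subr_eq0 -/w w0.
  have -> : 2 / sq w * ip w x = 1.
    have : 2 * ip w x = sq w by rewrite /w sqB !ipL (ipC y) -/(sq x) -xy; ring.
    by move=> e; rewrite mulrAC e divff ?gt_eqF.
  by rewrite scale1r opprB addrC subrK.
- by move=> z e; rewrite Hz ipC /w ipDr ipNr e subrr mulr0 scale0r subr0.
Qed.

Lemma orthogonal_move1 n (c e : 'cV[R]_n) : sq c = sq e ->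
  exists U : 'M[R]_n, U^T *m U = 1%:M /\ U^T *m c = e.
Proof.
by move=> /householder [H [HT HH Hc _]]; exists H; rewrite HT.
Qed.

(** A first reflection sends [c] to [e], a second one sends the image of [w] to [f]. The second
    fixes [e], because [e] has the same inner product with [f] as with the image of [w]. *)
Lemma orthogonal_move2 n (c w e f : 'cV[R]_n) :
  sq c = sq e -> sq w = sq f -> ip c w = ip e f ->
  exists U : 'M[R]_n, [/\ U^T *m U = 1%:M, U^T *m c = e & U^T *m w = f].
Proof.
move=> ce wf cwef; have [H [HT HH Hc _]] := householder ce.
have Hw : sq (H *m w) = sq f by rewrite -wf /sq ip_mulLl HT mulmxA HH mul1mx.
have [K [KT KK Kw Kz]] := householder Hw.
exists (H *m K); rewrite trmx_mul HT KT; split.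
- by rewrite mulmxA -(mulmxA K) HH mulmx1 KK.
- by rewrite -mulmxA Hc Kz // -cwef -Hc ip_mulLl HT mulmxA HH mul1mx.
- by rewrite -mulmxA Kw.
Qed.

Lemma sq_mulLorth m n (U : 'M[R]_m) (A : 'M_(m, n)) :
  U^T *m U = 1%:M -> sq (U *m A) = sq A.
Proof. by move=> hU; rewrite /sq ip_mulLl mulmxA hU mul1mx. Qed.

Lemma sq_mulRorth m n (U : 'M[R]_n) (A : 'M_(m, n)) :
  U *m U^T = 1%:M -> sq (A *m U) = sq A.
Proof. by move=> hU; rewrite /sq ip_mulRl -mulmxA hU mulmx1. Qed.

End Orthogonal.

(** * Block reduction of skew matrices and the commutator bound *)

Section SkewReduction.
Variable R : rcfType.
Implicit Types m n q k l : nat.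

(** [a] and [b] are the real and imaginary parts of a complex eigenvector for the eigenvalue s + i
    mu; they are rows because [eigenvalueP] speaks of left eigenvectors. *)
Lemma skew_complex_eigenvector n (X : 'M[R]_n) : (0 < n)%N ->
  exists (s mu : R) (a b : 'rV_n),
    [/\ a *m X = s *: a - mu *: b, b *m X = s *: b + mu *: a &
        (a != 0) || (b != 0)].
Proof.
move=> n_gt0; pose f := real_complex R.
have [[s mu] /eigenvalueP[v vX v0]] := eigenvalue_closed (map_mx f X) n_gt0.
exists s, mu, (map_mx (@complex.Re R) v), (map_mx (@complex.Im R) v).
have vE : v = map_mx f (map_mx (@complex.Re R) v) + 'i%C *: map_mx f (map_mx (@complex.Im R) v).
  by apply/matrixP => i j; rewrite !mxE; exact: complexE.
move: (map_mx _ v) (map_mx (@complex.Im R) v) vE => a b vE.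
have {}vX (k : 'I_n) : (a *m X) 0 k = (s *: a - mu *: b) 0 k /\
    (b *m X) 0 k = (s *: b + mu *: a) 0 k.
  move/matrixP: vX => /(_ 0 k); rewrite vE mulmxDl -scalemxAl -!map_mxM !mxE.
  move: (\sum_j _) (\sum_j _) => x y; rewrite /f /=; simpc => -[-> ->].
  by split; ring.
split; try by apply/matrixP => i k; rewrite ord1; case: (vX k).
apply: contraNT v0; rewrite negb_or !negbK vE => /andP[/eqP-> /eqP->].
by rewrite !map_mx0 scaler0 addr0.
Qed.

(** Adding <X a, a> = 0 and <X b, b> = 0 forces the real part of the eigenvalue to vanish. The
    relations between [a] and [b] keep the factor [mu], since for [mu = 0] nothing relates these two
    kernel vectors. *)
Lemma skew_eigenplane n (X : 'M[R]_n) : (0 < n)%N -> X^T = - X ->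
  exists (mu : R) (a b : 'cV_n),
    [/\ X *m a = mu *: b, X *m b = - mu *: a, mu * ip a b = 0,
        mu * sq a = mu * sq b & (a != 0) || (b != 0)].
Proof.
move=> n_gt0 skX.
have [s [mu [a [b [/(congr1 trmx) aX /(congr1 trmx) bX ab]]]]] :=
  skew_complex_eigenvector X n_gt0.
have {}ab : (a^T != 0) || (b^T != 0).
  by rewrite -!(inj_eq trmx_inj _ 0) !trmxK trmx0.
move: ab aX bX; rewrite !trmx_mul !linearD !linearN !linearZ /= skX !mulNmx.
move: a^T b^T => {}a {}b ab /(canRL (@opprK _)) aX /(canRL (@opprK _)) bX.
exists mu, a, b.
have haa := ip_skew a skX; have hbb := ip_skew b skX.
have hab : ip (X *m a) b = - ip a (X *m b) by rewrite ip_mulLl skX mulNmx ipNr.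
move: haa hbb hab; rewrite aX bX !ipL (ipC b a) -!/(sq _) => haa hbb hab.
have s0 : s = 0.
  have /eqP : s * (sq a + sq b) = 0 by lra.
  rewrite mulf_eq0 => /orP[/eqP //|]; have := sq_ge0 a; have := sq_ge0 b.
  by case/orP: ab => /sq_gt0; lra.
move: haa hab; rewrite s0 !scale0r !add0r scaleNr scalerN opprK => haa hab.
by split=> //; rewrite ?opprK //; lra.
Qed.

Lemma row_mx_orthonormal n (a b : 'cV[R]_n) :
  (row_mx a b)^T *m row_mx a b = 1%:M <-> [/\ sq a = 1, sq b = 1 & ip a b = 0].
Proof.
rewrite tr_row_mx mul_col_row scalar_mx_block !tr_mul_vec; split.
  move=> /eq_block_mx.
  move=> [/matrixP /(_ 0 0) + /matrixP /(_ 0 0) + _ /matrixP /(_ 0 0)].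
  by rewrite !mxE.
by move=> [ha hb hab]; rewrite (ipC b) hab -/(sq a) -/(sq b) ha hb raddf0.
Qed.

Lemma skew_blockP k l (Y : 'M[R]_(k + l)) : Y^T = - Y ->
  exists Q C Y', [/\ Q^T = - Q, Y'^T = - Y' & Y = block_mx Q (- C^T) C Y'].
Proof.
move=> skY; exists (ulsubmx Y), (dlsubmx Y), (drsubmx Y).
have := skY; rewrite -{1 2}[Y]submxK tr_block_mx opp_block_mx.
move=> /eq_block_mx [h1 h2 h3 h4]; split=> //.
by rewrite -[LHS]submxK h2 opprK.
Qed.

Lemma conj_skew n (U X : 'M[R]_n) : X^T = - X ->
  (U^T *m X *m U)^T = - (U^T *m X *m U).
Proof. by move=> skX; rewrite !trmx_mul trmxK skX mulNmx mulmxN mulmxA. Qed.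

(** The columns of [C] span an invariant subspace of [X], which [U^T] carries to the first [k]
    coordinates. Hence the lower-left block vanishes, and by skewness the upper-right one too. *)
Lemma skew_invariant_block k l (X : 'M[R]_(k + l)) (U : 'M_(k + l))
    (C : 'M_(k + l, k)) (P : 'M_k) :
  X^T = - X -> U^T *m U = 1%:M -> U^T *m C = col_mx 1%:M 0 ->
  X *m C = C *m P ->
  exists (P' : 'M_k) (X' : 'M_l), [/\ P'^T = - P', X'^T = - X' &
    U^T *m X *m U = block_mx P' 0 0 X'].
Proof.
move=> skX UU UC XC; have UU' := mulmx1C UU.
have /skew_blockP [Q [D [X' [skQ skX' E]]]] := conj_skew U skX.
exists Q, X'; split=> //.
have : U^T *m X *m U *m (U^T *m C) = U^T *m C *m P.
  by rewrite mulmxA -(mulmxA _ U) UU' mulmx1 -!mulmxA XC.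
rewrite UC E mul_block_col mul_col_mx !mulmx0 !mulmx1 !addr0 mul1mx mul0mx.
by move=> /eq_col_mx [_ ->]; rewrite trmx0 oppr0.
Qed.

Lemma skew_reduction n (X : 'M[R]_n) : (0 < n)%N -> X^T = - X ->
  exists k l (e : n = (k + l)%N), [/\ (0 < k)%N, (k <= 2)%N &
    exists (U : 'M_(k + l)) (P : 'M_k) (X' : 'M_l),
     [/\ U^T *m U = 1%:M, P^T = - P, X'^T = - X' &
         U^T *m castmx (e, e) X *m U = block_mx P 0 0 X']].
Proof.
move=> n_gt0 skX.
have [mu [a [b [Xa Xb hab ab hnz]]]] := skew_eigenplane n_gt0 skX.
have W1 k l : (col_mx 1%:M 0 : 'M[R]_(k + l, k))^T *m col_mx 1%:M 0 = 1%:M.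
  by rewrite tr_col_mx mul_row_col !trmx1 mulmx1 mulmx0 addr0.
(* For [mu = 0] a kernel vector splits off a block of size 1; otherwise [a] and [b] are orthogonal
   of equal norm and split off a block of size 2. *)
have [mu0|mu_neq0] := eqVneq mu 0.
  have [c c0 Xc] : exists2 c : 'cV_n, c != 0 & X *m c = 0.
    case/orP: hnz => [a0|b0]; [exists a | exists b] => //.
      by rewrite Xa mu0 scale0r.
    by rewrite Xb mu0 oppr0 scale0r.
  case: n X n_gt0 skX c c0 Xc {a b Xa Xb hab ab hnz} => // l X _ skX c.
  move=> /sq_gt0 c0 Xc.
  exists 1%N, l, erefl; split=> //; rewrite castmx_id.
  pose d := (Num.sqrt (sq c))^-1 *: c.
  have d1 : sq d = sq (col_mx 1%:M 0 : 'cV_(1 + l)).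
    rewrite {2}/sq /ip W1 mxtrace1 /d sqZ exprVn sqr_sqrtr ?ltW // mulVf //.
    by rewrite gt_eqF.
  have [U [UU Ud]] := orthogonal_move1 d1.
  have Xd : X *m d = d *m 0 by rewrite -scalemxAr Xc scaler0 mulmx0.
  have [P' [X' [? ? ?]]] := @skew_invariant_block 1 l X U d 0 skX UU Ud Xd.
  by exists U, P', X'.
have {}hab : ip a b = 0 by move/eqP: hab; rewrite mulf_eq0 (negPf mu_neq0) => /eqP.
have {}ab : sq a = sq b by apply: (mulfI mu_neq0).
have a0 : 0 < sq a.
  by case/orP: hnz => [/sq_gt0 //|/sq_gt0]; rewrite ab.
pose r := (Num.sqrt (sq a))^-1.
have r2 : r ^+ 2 * sq a = 1.
  by rewrite exprVn sqr_sqrtr ?ltW // mulVf // gt_eqF.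
(* In dimension 1, orthogonality would make [a] or [b] zero, contradicting their common positive
   norm. *)
have n_gt1 : (2 <= n)%N.
  case: n X n_gt0 skX a b Xa Xb hab {hnz} ab a0 @r r2 => [//|[|//]] X _ _ a b _ _.
  move=> + ab a0 _ _.
  rewrite ipE !big_ord1 => /eqP; rewrite mulf_eq0 => /orP[] /eqP z0.
    by move: a0; rewrite sqE !big_ord1 z0 expr0n ltxx.
  by move: a0; rewrite ab sqE !big_ord1 z0 expr0n ltxx.
case: n n_gt1 X {n_gt0} skX a b Xa Xb hab {hnz} ab a0 @r r2 => [//|[//|l]] _ X.
move=> skX a b Xa Xb hab ab a0 r r2.
exists 2%N, l, erefl; split=> //; rewrite castmx_id.
(* The width is written [1 + 1] so that [lsubmx] and [rsubmx] extract the two columns. *)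
pose W : 'M[R]_(2 + l, 1 + 1) := col_mx 1%:M 0.
have [w1 w2 w12] : [/\ sq (lsubmx W) = 1, sq (rsubmx W) = 1
    & ip (lsubmx W) (rsubmx W) = 0].
  by apply/row_mx_orthonormal; rewrite hsubmxK W1.
have [||| U [UU Ua Ub]] :=
  @orthogonal_move2 R _ (r *: a) (r *: b) (lsubmx W) (rsubmx W).
- by rewrite sqZ r2 w1.
- by rewrite sqZ -ab r2 w2.
- by rewrite ipZl ipZr hab w12 !mulr0.
have UC : U^T *m row_mx (r *: a) (r *: b) = W.
  by rewrite mul_mx_row Ua Ub hsubmxK.
have XC : X *m row_mx (r *: a) (r *: b)
    = row_mx (r *: a) (r *: b) *m block_mx 0 (- mu)%:M mu%:M 0.
  rewrite mul_row_block mul_mx_row !mulmx0 !mul_mx_scalar addr0 add0r.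
  by rewrite -!scalemxAr Xa Xb !scalerA ![_ * r]mulrC.
have [P' [X' [? ? ?]]] := @skew_invariant_block 2 l X U _ _ skX UU UC XC.
by exists U, P', X'.
Qed.

Definition comm n (X Y : 'M[R]_n) : 'M[R]_n := X *m Y - Y *m X.

Lemma sq_comm_conj n (U X Y : 'M[R]_n) : U^T *m U = 1%:M ->
  sq (comm (U^T *m X *m U) (U^T *m Y *m U)) = sq (comm X Y).
Proof.
move=> UU; have UU' := mulmx1C UU.
have E (A B : 'M_n) : U^T *m A *m U *m (U^T *m B *m U) = U^T *m (A *m B) *m U.
  by rewrite !mulmxA -(mulmxA (U^T *m A)) UU' mulmx1.
by rewrite /comm !E -mulmxBl -mulmxBr sq_mulRorth // sq_mulLorth // trmxK.
Qed.

(** One formula covers all sizes up to 2: the matrix with entries j - i is zero in size 1 and the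
    quarter turn in size 2. *)
Lemma skew_small k (A : 'M[R]_k) : (k <= 2)%N -> A^T = - A ->
  exists a, A = a *: \matrix_(i, j) (j%:R - i%:R).
Proof.
move=> k2 /matrixP skA.
have E i j : A i j = - A j i by have := skA j i; rewrite !mxE.
have Z i : A i i = 0 by have := E i i; lra.
case: k k2 A {skA} E Z => [|[|[|//]]] _ A E Z.
- by exists 0; rewrite [LHS]flatmx0 [RHS]flatmx0.
- by exists 0; apply/matrixP => i j; rewrite !ord1 Z scale0r mxE.
exists (A 0 1); apply/matrixP => i j; rewrite !mxE.
have ord2 (h : 'I_2) : h = 0 \/ h = 1.
  by case: h => [[|[|//]] hh]; [left | right]; exact: val_inj.
by case: (ord2 i) => ->; case: (ord2 j) => ->; rewrite ?Z ?(E 1 0) /= ?modn_small //; ring.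
Qed.

Lemma comm_small k (P Q : 'M[R]_k) : (k <= 2)%N ->
  P^T = - P -> Q^T = - Q -> comm P Q = 0.
Proof.
move=> k2 /(skew_small k2) [a ->] /(skew_small k2) [b ->].
by rewrite /comm -!scalemxAl -!scalemxAr !scalerA mulrC subrr.
Qed.

Lemma comm_block k l (P Q : 'M[R]_k) (X Y : 'M_l) (C : 'M_(l, k)) :
  P^T = - P -> X^T = - X ->
  comm (block_mx P 0 0 X) (block_mx Q (- C^T) C Y)
  = block_mx (comm P Q) (- (X *m C - C *m P)^T) (X *m C - C *m P) (comm X Y).
Proof.
move=> skP skX; rewrite /comm !mulmx_block !mul0mx !mulmx0 !addr0 !add0r.
rewrite opp_block_mx add_block_mx linearB /= !trmx_mul skX skP.
by congr block_mx; rewrite !mulmxN !mulNmx !opprK opprD opprK addrC.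
Qed.

Lemma sq_comm_skew n (X Y : 'M[R]_n) : X^T = - X -> Y^T = - Y ->
  sq (comm X Y) <= sq X * sq Y.
Proof.
elim/ltn_ind: n X Y => n IH X Y skX skY.
have [n0|n_gt0] := posnP n.
  by subst n; rewrite (flatmx0 (comm X Y)) sq0 mulr_ge0 ?sq_ge0.
have [k [l [e [k_gt0 k2 [U [P [X' [UU skP skX' XE]]]]]]]] :=
  skew_reduction n_gt0 skX.
subst n; rewrite castmx_id in XE.
have /skew_blockP [Q [C [Y' [skQ skY' YE]]]] := conj_skew U skY.
have UV := mulmx1C UU; have UU' : U^T^T *m U^T = 1%:M by rewrite trmxK.
have conj_sq (Z : 'M[R]_(k + l)) : sq Z = sq (U^T *m Z *m U).
  by rewrite (sq_mulRorth _ UV) (sq_mulLorth _ UU').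
rewrite -(sq_comm_conj X Y UU) (conj_sq X) (conj_sq Y) XE YE comm_block //.
rewrite /sq !ip_block -!/(sq _) comm_small // sq0 !sqN !sq_tr !sq0.
have h1 := sq_skew_mulmx C skX'; have h2 := sq_mulmx_skew C skP.
have h3 := sqB_le (X' *m C) (C *m P).
have h4 : sq (comm X' Y') <= sq X' * sq Y'.
  by apply: IH => //; rewrite -{1}(add0n l) ltn_add2r.
(* These three products of squared norms occur only in the expansion of the right-hand side and are
   dropped. *)
have := mulr_ge0 (sq_ge0 P) (sq_ge0 Q); have := mulr_ge0 (sq_ge0 P) (sq_ge0 Y').
have := mulr_ge0 (sq_ge0 X') (sq_ge0 Q); lra.
Qed.

End SkewReduction.

(** * The curvature in terms of blocks, and its upper bounds *)

Section Curvature.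
Variable R : rcfType.
Implicit Types m p q : nat.

(* [horizontal] with the size of the lower block freed from [n - p]; rank-one
   B-blocks are reduced to the case of a single row. *)
Definition hmx m p (A : 'M[R]_p) (B : 'M[R]_(m, p)) : 'M[R]_(p + m) :=
  block_mx A (- B^T) B 0.

Definition curv m p (A1 A2 : 'M[R]_p) (B1 B2 : 'M[R]_(m, p)) : R :=
  2^-1 * sq (altprod B1 B2) + 4^-1 * sq (B1 *m A2 - B2 *m A1)
  + 8^-1 * sq (comm A1 A2 - (B1^T *m B2 - B2^T *m B1)).

Definition orthonormal_blocks m p (A1 A2 : 'M[R]_p) (B1 B2 : 'M[R]_(m, p)) :=
  [/\ A1^T = - A1 /\ A2^T = - A2, 2^-1 * sq A1 + sq B1 = 1,
      2^-1 * sq A2 + sq B2 = 1 & 2^-1 * ip A1 A2 + ip B1 B2 = 0].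

Lemma ip_hmx m p (A1 A2 : 'M[R]_p) (B1 B2 : 'M[R]_(m, p)) :
  ip (hmx A1 B1) (hmx A2 B2) = ip A1 A2 + 2 * ip B1 B2.
Proof. by rewrite ip_block ip0r !ipL ip_tr; ring. Qed.

Lemma hmx_skew m p (A : 'M[R]_p) (B : 'M[R]_(m, p)) :
  A^T = - A -> (hmx A B)^T = - hmx A B.
Proof.
move=> skA; rewrite /hmx tr_block_mx opp_block_mx linearN /= trmxK skA.
by rewrite trmx0 oppr0 opprK.
Qed.

Lemma curvC m p (A1 A2 : 'M[R]_p) (B1 B2 : 'M[R]_(m, p)) :
  curv A2 A1 B2 B1 = curv A1 A2 B1 B2.
Proof.
rewrite /curv altprodC sqN -(opprB (B1 *m A2)) sqN.
have -> : comm A2 A1 - (B2^T *m B1 - B1^T *m B2)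
  = - (comm A1 A2 - (B1^T *m B2 - B2^T *m B1)).
  by rewrite [RHS]opprD !opprB.
by rewrite sqN.
Qed.

(** The three terms of [curv] are the blocks of the commutator. The off-diagonal block occurs twice,
    whence 2/8 = 1/4; [altprod] has weight 1/2 in [curv] but only 1/8 in the commutator, which
    leaves 3/8. *)
Lemma curv_comm m p (A1 A2 : 'M[R]_p) (B1 B2 : 'M[R]_(m, p)) :
  A1^T = - A1 -> A2^T = - A2 ->
  curv A1 A2 B1 B2 = 8^-1 * sq (comm (hmx A1 B1) (hmx A2 B2))
                     + 3 / 8 * sq (altprod B1 B2).
Proof.
move=> sk1 sk2.
have -> : comm (hmx A1 B1) (hmx A2 B2) =
  block_mx (comm A1 A2 - (B1^T *m B2 - B2^T *m B1)) (- (B1 *m A2 - B2 *m A1)^T)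
           (B1 *m A2 - B2 *m A1) (altprod B1 B2).
  rewrite /comm !mulmx_block !mul0mx !mulmx0 !addr0 opp_block_mx add_block_mx.
  rewrite [(_ - _)^T]linearB /= !trmx_mul sk1 sk2 !mulmxN !mulNmx !opprD !opprK.
  by rewrite addrACA [- (A1 *m _) + _]addrC [- (B1 *m _) + _]addrC.
rewrite {1}/sq ip_block -!/(sq _) sqN sq_tr /curv; lra.
Qed.

Lemma curv_ge0 m p (A1 A2 : 'M[R]_p) (B1 B2 : 'M[R]_(m, p)) :
  0 <= curv A1 A2 B1 B2.
Proof. by rewrite /curv !addr_ge0 ?mulr_ge0 ?invr_ge0 ?ler0n ?sq_ge0. Qed.

Lemma sq_comm_orthonormal m p (A1 A2 : 'M[R]_p) (B1 B2 : 'M[R]_(m, p)) :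
  orthonormal_blocks A1 A2 B1 B2 -> sq (comm (hmx A1 B1) (hmx A2 B2)) <= 4.
Proof.
move=> [[sk1 sk2] n1 n2 _].
have := sq_comm_skew (hmx_skew B1 sk1) (hmx_skew B2 sk2).
rewrite /sq !ip_hmx -!/(sq _).
have -> : sq A1 + 2 * sq B1 = 2 by lra.
have -> : sq A2 + 2 * sq B2 = 2 by lra.
lra.
Qed.

Lemma curv_le54 m p (A1 A2 : 'M[R]_p) (B1 B2 : 'M[R]_(m, p)) :
  orthonormal_blocks A1 A2 B1 B2 -> curv A1 A2 B1 B2 <= 5 / 4.
Proof.
move=> on; have := sq_comm_orthonormal on; have [[sk1 sk2] n1 n2 _] := on.
rewrite curv_comm //; have := sq_altprod_le B1 B2.
have := sq_ge0 A1; have := sq_ge0 A2; have := sq_ge0 B1; have := sq_ge0 B2.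
by move: n1 n2; set b1 := sq B1; set b2 := sq B2; nra.
Qed.

Lemma altprod_small m p (B1 B2 : 'M[R]_(m, p)) : (m <= 1)%N -> altprod B1 B2 = 0.
Proof.
move=> m1; have [|a ->] := skew_small _ (altprod_skew B1 B2).
  exact: leq_trans m1 _.
case: m m1 B1 B2 => [|[|//]] _ _ _; first exact: flatmx0.
by apply/matrixP => i j; rewrite !ord1 !mxE subrr mulr0.
Qed.

(** This is the curvature formula of a special orthogonal group with its bi-invariant metric: 1/4 of
    the squared commutator in the norm of [dotQ]. *)
Lemma curv_small m p (A1 A2 : 'M[R]_p) (B1 B2 : 'M[R]_(m, p)) : (m <= 1)%N ->
  A1^T = - A1 -> A2^T = - A2 ->
  curv A1 A2 B1 B2 = 8^-1 * sq (comm (hmx A1 B1) (hmx A2 B2)).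
Proof. by move=> m1 *; rewrite curv_comm // altprod_small // sq0 mulr0 addr0. Qed.

Lemma curv_small_le12 m p (A1 A2 : 'M[R]_p) (B1 B2 : 'M[R]_(m, p)) :
  (m <= 1)%N -> orthonormal_blocks A1 A2 B1 B2 -> curv A1 A2 B1 B2 <= 1 / 2.
Proof.
move=> m1 on; have := sq_comm_orthonormal on; have [[sk1 sk2] _ _ _] := on.
by rewrite curv_small //; lra.
Qed.

Lemma sq_outer m p (u : 'cV[R]_m) (v : 'cV[R]_p) : sq (u *m v^T) = sq u * sq v.
Proof. by rewrite /sq ip_outer. Qed.

Lemma rank1_outer m p (B : 'M[R]_(m, p)) : \rank B = 1%N ->
  exists (u : 'cV[R]_m) (v : 'cV[R]_p), sq u = 1 /\ B = u *m v^T.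
Proof.
move=> rB; have : B != 0 by rewrite -mxrank_eq0 rB.
have := mulmx_base B; move: (col_base B) (row_base B); rewrite rB => u v <- B0.
have u0 : 0 < sq u.
  by apply: sq_gt0; apply: contraNneq B0 => ->; rewrite mul0mx.
pose r := Num.sqrt (sq u); have r0 : r != 0 by rewrite gt_eqF ?sqrtr_gt0.
exists (r^-1 *: u), (r *: v^T); split.
  by rewrite sqZ exprVn sqr_sqrtr ?ltW // mulVf ?gt_eqF.
by rewrite linearZ /= trmxK -scalemxAl -scalemxAr scalerA mulVf // scale1r.
Qed.

(** The columns of [B'] are orthogonal to [u], so no cross terms survive. The first term of the
    curvature reduces to the wedge of [B' *m v] and [u], the second gains the part [B' *m A1], and
    the third involves only [v] and [r]. *)
Lemma curv_rank1_split m p (A1 A2 : 'M[R]_p) (u : 'cV[R]_m) (v : 'cV[R]_p)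
    (B2 : 'M[R]_(m, p)) : sq u = 1 ->
  let r := B2^T *m u in let B' := B2 - u *m r^T in
  curv A1 A2 (u *m v^T) B2
  = curv A1 A2 v^T r^T + sq (B' *m v) + 4^-1 * sq (B' *m A1)
  /\ sq B2 = sq r + sq B'.
Proof.
move=> u1 r B'.
have B'u : B'^T *m u = 0.
  by rewrite linearB /= trmx_mul trmxK mulmxBl outer_mul -/(sq u) u1 scale1r subrr.
have B2E : B2 = u *m r^T + B' by rewrite addrC subrK.
have orth k (Z : 'M[R]_(p, k)) (y' : 'cV[R]_k) :
    ip (u *m y'^T) (B' *m Z) = 0.
  by rewrite ipC ip_outerr -mulmxA ip_mulLl B'u ip0r.
have altE : altprod (u *m v^T) B2 = (B' *m v) *m u^T - u *m (B' *m v)^T.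
  have B2v : B2 *m v = ip r v *: u + B' *m v by rewrite {1}B2E mulmxDl outer_mul.
  rewrite /altprod trmx_mul trmxK mulmxA -(mulmxA u) -trmx_mul B2v.
  rewrite mulmxDl linearD /= mulmxDr linearZ /= -scalemxAl -scalemxAr.
  by rewrite opprD addrACA subrr add0r.
have dlE : u *m v^T *m A2 - B2 *m A1 = u *m (v^T *m A2 - r^T *m A1) - B' *m A1.
  by rewrite {1}B2E mulmxDl mulmxBr !mulmxA opprD addrA.
have ulE : (u *m v^T)^T *m B2 - B2^T *m (u *m v^T) = v^T^T *m r^T - r^T^T *m v^T.
  by rewrite trmx_mul !trmxK mulmxA -/r -mulmxA -[u^T *m B2]trmxK trmx_mul trmxK.
split; last first.
  have := orth _ 1%:M r; rewrite mulmx1 => h.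
  rewrite {1}B2E -[B' in LHS]opprK sqB ipNr h sqN /sq ip_outer -/(sq u) u1.
  by rewrite oppr0 mulr0 subr0 mul1r.
rewrite /curv altE dlE ulE (altprod_small v^T) // sq0 sq_wedge -/(sq u) u1.
have -> : ip (B' *m v) u = 0 by rewrite ip_mulLl B'u ip0r.
have -> : sq (u *m (v^T *m A2 - r^T *m A1) - B' *m A1)
    = sq (v^T *m A2 - r^T *m A1) + sq (B' *m A1).
  rewrite sqB -[_ - r^T *m _]trmxK orth sq_outer u1 !sq_tr; lra.
lra.
Qed.

Lemma sq_mulmx_vec m p (B : 'M[R]_(m, p)) (v : 'cV_p) :
  sq (B *m v) <= sq B * sq v.
Proof.
rewrite -(sq_tr B) (sq_col B^T) (sqE (B *m v)) mulr_suml; apply: ler_sum => i _.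
rewrite big_ord1; apply: le_trans (cauchy_schwarz _ _).
rewrite le_eqVlt ipE !mxE; apply/orP; left; apply/eqP; congr (_ ^+ 2).
by apply: eq_bigr => j _; rewrite big_ord1 !mxE.
Qed.

Lemma curv_rank1 m p (A1 A2 : 'M[R]_p) (B1 B2 : 'M[R]_(m, p)) :
  orthonormal_blocks A1 A2 B1 B2 -> \rank B1 = 1%N -> curv A1 A2 B1 B2 <= 1.
Proof.
move=> [[sk1 sk2] n1 n2 _] /rank1_outer [u [v [u1 B1E]]].
move: n1; rewrite B1E sq_outer u1 mul1r => n1.
have [-> ] := curv_rank1_split A1 A2 v B2 u1.
set r := B2^T *m u; set B' := B2 - _ => sB2.
rewrite curv_small //.
have := sq_comm_skew (hmx_skew v^T sk1) (hmx_skew r^T sk2).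
rewrite /sq !ip_hmx -!/(sq _) !sq_tr.
have -> : sq A1 + 2 * sq v = 2 by lra.
have -> : sq A2 + 2 * sq r = 2 - 2 * sq B' by lra.
have := sq_mulmx_skew B' sk1.
have : sq (B' *m v) <= sq v * sq B'.
  by rewrite mulrC sq_mulmx_vec.
(* With b = |B'|^2 and t = |v|^2, both at most 1, the bounds add up to (1 - b)/2 + t b + (1 - t) b/4
   = 1/2 + b (3 t - 1)/4 <= 1. *)
have := sq_ge0 A1; have := sq_ge0 A2; have := sq_ge0 v; have := sq_ge0 B'.
have := sq_ge0 r; nra.
Qed.
End Curvature.

(** * Pairs of blocks with curvature 5/4 *)

Section Extremal.
Variable R : rcfType.
Implicit Types m p q : nat.

Definition orthopair n (c w : 'cV[R]_n) := [/\ sq c = 1, sq w = 1 & ip c w = 0].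

(** With respect to [c, w] and [d, z] the arguments are multiples of a quarter turn and of the
    identity. Applied to transposes with the two pairs exchanged, this also computes
    [B1^T *m B2 - B2^T *m B1]. Orthonormality is asked of one pair only, since the equality case has
    yet to derive it for the other. *)
Lemma altprod_frame m p (c w : 'cV[R]_m) (d z : 'cV[R]_p) (a b : R) :
  orthopair d z ->
  altprod (a *: (c *m z^T - w *m d^T)) (b *: (c *m d^T + w *m z^T))
  = (2 * (a * b)) *: (w *m c^T - c *m w^T).
Proof.
move=> [d1 z1 dz]; have zd : ip z d = 0 by rewrite ipC.
rewrite /altprod !linearZ /= [(_ - _)^T]linearB /= [(_ + _)^T]linearD /=.
rewrite !trmx_mul !trmxK.
rewrite -!scalemxAl scalerN !scalerA (mulrC b) -scalerBr.
rewrite !mulmxDl !mulmxDr !mulNmx !mulmxN !mulmxA !outer_mul.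
rewrite -/(sq d) -/(sq z) d1 z1 dz zd !scale0r !scale1r !mul0mx !oppr0.
rewrite !addr0 !add0r.
by rewrite opprB [- _ + _]addrC -mulr2n -scaler_nat scalerA mulrC.
Qed.

Lemma curv_extremal m p (A1 A2 : 'M[R]_p) (B1 B2 : 'M[R]_(m, p)) :
  orthonormal_blocks A1 A2 B1 B2 -> curv A1 A2 B1 B2 = 5 / 4 ->
  [/\ A1 = 0, A2 = 0 & exists (c w : 'cV[R]_m) (d z : 'cV[R]_p),
    [/\ orthopair c w, orthopair d z,
        B1 = (Num.sqrt 2)^-1 *: (c *m d^T + w *m z^T) &
        B2 = (Num.sqrt 2)^-1 *: (w *m d^T - c *m z^T)]].
Proof.
move=> on K54; have cm := sq_comm_orthonormal on; have [[sk1 sk2] n1 n2 _] := on.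
move: (K54); rewrite curv_comm // => K54'.
have al := sq_altprod_le B1 B2.
(* The commutator contributes at most 1/2, so |M|^2 >= 2 and |B1|^2 |B2|^2 >= 1, while both factors
   are at most 1. *)
have [a1 a2] : sq A1 = 0 /\ sq A2 = 0.
  have := sq_ge0 A1; have := sq_ge0 A2; have := sq_ge0 B1; have := sq_ge0 B2.
  move: n1 n2 al; set b1 := sq B1; set b2 := sq B2; set x := sq A1; set y := sq A2.
  move=> n1 n2 al b20 b10 y0 x0.
  have h : 1 <= b1 * b2 by lra.
  have xE : x = 2 * (1 - b1) by lra.
  have yE : y = 2 * (1 - b2) by lra.
  split; nra.
have b1 : sq B1 = 1 by lra.
have b2 : sq B2 = 1 by lra.
move: (sq_eq0 a1) (sq_eq0 a2) K54 => -> -> K54; split=> //.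
move: K54; rewrite /curv /comm !mulmx0 subrr sq0 mulr0 addr0 sub0r oppr0 sub0r sqN.
set N := B1^T *m B2 - B2^T *m B1 => K54.
have NE : N = altprod B2^T B1^T by rewrite /altprod !trmxK.
(* Both |M|^2 and |N|^2 are at most 2, and 1/2 * 2 + 1/8 * 2 = 5/4 leaves no slack in either. *)
have N2 : sq N <= 2 by rewrite NE (le_trans (sq_altprod_le _ _)) // !sq_tr b1 b2; lra.
have M2 : sq (altprod B1 B2) = 2 by move: al; rewrite b1 b2; lra.
have {}N2 : sq N = 2 by lra.
have [B2E B1E] := altprod_extremal b1 b2 M2.
have skM := altprod_skew B1 B2.
move: M2 B1E B2E skM; set M := altprod B1 B2 => M2 B1E B2E skM.
(* As M B1 = B2 and M B2 = - B1, [M] turns every column of [B1] by a quarter turn, so any nonzero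
   column determines the plane of [M]. *)
have [j bj] : exists j, col j B1 != 0.
  apply/existsP; apply: contra_eqT b1; rewrite negb_exists => /forallP B10.
  rewrite sq_col big1 1?eq_sym ?oner_eq0 // => j _.
  by have := B10 j; rewrite negbK => /eqP ->; rewrite sq0.
have b0 := sq_gt0 bj; pose c := (Num.sqrt (sq (col j B1)))^-1 *: col j B1.
have c1 : sq c = 1 by rewrite sqZ exprVn sqr_sqrtr ?ltW // mulVf // gt_eqF.
pose w := M *m c.
have Mw : M *m w = - c.
  rewrite /w /c -!scalemxAr -!col_mulmx -B2E -scalerN; congr (_ *: _).
  by rewrite B1E; apply/matrixP => i k; rewrite !mxE opprK.
have w1 : sq w = 1.
  have := sq_skew_mulmx_vec c skM; have := sq_skew_mulmx_vec w skM.
  by rewrite Mw sqN -/w c1 M2; lra.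
have cw : ip c w = 0 by rewrite ipC ip_skew.
have ME : M = w *m c^T - c *m w^T.
  by apply: sq_skew_mulmx_eq => //; rewrite -/w w1 M2; lra.
have Mc : M *m c = w by [].
clearbody w; clearbody c.
pose s : R := Num.sqrt 2; have s0 : s != 0 by rewrite gt_eqF // sqrtr_gt0 ltr0n.
have s2 : s ^+ 2 = 2 by rewrite sqr_sqrtr ?ler0n.
(* Up to the factor sqrt 2, these are the coefficient rows of [B1] along [c] and [w]. *)
pose d := s *: (B1^T *m c); pose z := s *: (B1^T *m w).
have cB : c^T *m B1 = s^-1 *: d^T.
  by rewrite /d linearZ /= scalerA mulVf // scale1r trmx_mul trmxK.
have wB : w^T *m B1 = s^-1 *: z^T.
  by rewrite /z linearZ /= scalerA mulVf // scale1r trmx_mul trmxK.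
clearbody d z.
have B2F : B2 = s^-1 *: (w *m d^T - c *m z^T).
  by rewrite B2E ME mulmxBl -!mulmxA cB wB -!scalemxAr scalerBr.
have B1F : B1 = s^-1 *: (c *m d^T + w *m z^T).
  rewrite B1E B2F -scalemxAr mulmxBr !mulmxA Mw Mc mulNmx -scalerN.
  by rewrite opprB opprK addrC.
have nB : sq d + sq z = 2.
  move: b1; rewrite {1}B1F sqZ exprVn s2 /sq !ipL !ip_outer -!/(sq _).
  by rewrite c1 w1 (ipC w) cw; lra.
have nN : sq d * sq z - ip d z ^+ 2 = 1.
  have := N2; rewrite NE B1F B2F !linearZ /=.
  rewrite [(_ - _)^T]linearB /= [(_ + _)^T]linearD /= !trmx_mul !trmxK altprod_frame //.
  rewrite sqZ sq_wedge (ipC z).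
  have -> : 2 * (s^-1 * s^-1) = 1 by rewrite -expr2 exprVn s2; lra.
  lra.
exists c, w, d, z; split=> //.
have := sqr_ge0 (sq d - sq z); have := sqr_ge0 (ip d z).
move: nB nN; set x := sq d; set y := sq z; set t := ip d z => nB nN t0 xy0.
(* Indeed (x - y)^2 + 4 t^2 = (x + y)^2 - 4 (x y - t^2) = 4 - 4 = 0. *)
have t00 : t ^+ 2 = 0 by nra.
have xy : (x - y) ^+ 2 = 0 by nra.
by split; [move/eqP: xy; rewrite sqrf_eq0 => /eqP; lra
  | move/eqP: xy; rewrite sqrf_eq0 => /eqP; lra
  | move/eqP: t00; rewrite sqrf_eq0 => /eqP].
Qed.

End Extremal.

(** * Commutators in so(3) and so(4), and standard basis vectors *)

Section LowDimension.
Variable R : rcfType.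
Implicit Types m n p q : nat.

(** Lagrange's identity for the cross product under the identification of so(3) with 3-space, which
    doubles inner products. It is checked on the entries above the diagonal. *)
Lemma sq_comm_skew3 (X Y : 'M[R]_3) : X^T = - X -> Y^T = - Y ->
  2 * sq (comm X Y) = sq X * sq Y - ip X Y ^+ 2.
Proof.
have E (A : 'M[R]_3) i j : A^T = - A -> A i j = - A j i.
  by move=> /matrixP /(_ j i); rewrite !mxE.
have Z (A : 'M[R]_3) i : A^T = - A -> A i i = 0 by move=> /(E A i i); lra.
move=> skX skY; rewrite !sqE ipE !big_ord_recl !big_ord0 !mxE.
rewrite !big_ord_recl !big_ord0 !(Z X) // !(Z Y) //.
set i1 := lift ord0 ord0; set i2 := lift ord0 (lift ord0 ord0).
rewrite (E X i1 ord0) // (E X i2 ord0) // (E X i2 i1) //.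
rewrite (E Y i1 ord0) // (E Y i2 ord0) // (E Y i2 i1) //.
ring.
Qed.

(** The lower-right block is skew of size at most 1, hence zero: every skew matrix is horizontal
    here. *)
Lemma skew_hmx m p (X : 'M[R]_(p + m)) : (m <= 1)%N -> X^T = - X ->
  exists A B, A^T = - A /\ X = hmx A B.
Proof.
move=> m1 /skew_blockP [A [B [D [skA skD ->]]]]; exists A, B; split=> //.
have [|a ->] := skew_small _ skD; first exact: leq_trans m1 _.
case: m m1 B {X D skD} => [|[|//]] _ B; rewrite /hmx; congr block_mx.
  by rewrite [LHS]flatmx0.
by apply/matrixP => i j; rewrite !ord1 !mxE subrr mulr0.
Qed.

(* Left multiplication by i and j on the quaternions: they lie in one so(3)
   factor of so(4), on which |[X,Y]| = |X| |Y| for orthogonal X, Y. *)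
Definition quat_i : 'M[R]_4 := \matrix_(i, j)
  nth 0 (nth [::] [:: [:: 0; 1; 0; 0]; [:: -1; 0; 0; 0];
                      [:: 0; 0; 0; 1]; [:: 0; 0; -1; 0]] i) j.

Definition quat_j : 'M[R]_4 := \matrix_(i, j)
  nth 0 (nth [::] [:: [:: 0; 0; 1; 0]; [:: 0; 0; 0; -1];
                      [:: -1; 0; 0; 0]; [:: 0; 1; 0; 0]] i) j.

Lemma quat_skew : quat_i^T = - quat_i /\ quat_j^T = - quat_j.
Proof.
split; apply/matrixP => -[[|[|[|[|//]]]] ?] [[|[|[|[|//]]]] ?];
  by rewrite !mxE /= ?opprK ?oppr0.
Qed.

Lemma sq_quat : [/\ sq quat_i = 4, sq quat_j = 4, ip quat_i quat_j = 0 &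
  sq (comm quat_i quat_j) = 16].
Proof.
split; rewrite ?sqE ?ipE !big_ord_recl !big_ord0 !mxE /=
  ?big_ord_recl ?big_ord0 ?mxE /=; ring.
Qed.

(** The quaternion pair is placed in the upper-left corner by the isometry [P] and scaled by 1 /
    sqrt 2, which turns squared norm 4 into 2 and 16 into 4 for the commutator. *)
Lemma orthonormal_so4 n : (4 <= n)%N -> exists X Y : 'M[R]_n,
  [/\ X^T = - X /\ Y^T = - Y, sq X = 2, sq Y = 2, ip X Y = 0 &
      sq (comm X Y) = 4].
Proof.
move=> n4; pose P : 'M[R]_(n, 4) := pid_mx 4; pose r : R := (Num.sqrt 2)^-1.
have r2 : r ^+ 2 = 2^-1 by rewrite exprVn sqr_sqrtr ?ler0n.
have PP : P^T *m P = 1%:M.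
  by rewrite tr_pid_mx mul_pid_mx !minnn (minn_idPr n4) pid_mx_1.
have ipP (A B : 'M[R]_4) : ip (P *m A *m P^T) (P *m B *m P^T) = ip A B.
  by rewrite ip_mulRl trmxK -mulmxA PP mulmx1 ip_mulLl mulmxA PP mul1mx.
have mulP (A B : 'M[R]_4) :
    P *m A *m P^T *m (P *m B *m P^T) = P *m (A *m B) *m P^T.
  by rewrite !mulmxA -(mulmxA (P *m A)) PP mulmx1.
have [skI skJ] := quat_skew; have [I4 J4 IJ IJ16] := sq_quat.
exists (r *: (P *m quat_i *m P^T)), (r *: (P *m quat_j *m P^T)); split.
- rewrite !linearZ /= !trmx_mul !trmxK skI skJ !mulNmx !mulmxN !scalerN.
  by rewrite !mulmxA.
- by rewrite sqZ /sq ipP -/(sq _) I4 r2; lra.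
- by rewrite sqZ /sq ipP -/(sq _) J4 r2; lra.
- by rewrite ipZl ipZr ipP IJ !mulr0.
rewrite /comm -!scalemxAl -!scalemxAr !scalerA !mulP -scalerBr -mulmxBl -mulmxBr.
by rewrite sqZ /sq ipP -/(sq _) IJ16 -expr2 r2; lra.
Qed.

(** The index is a natural number, and the vector is zero when [n <= k]; this matches the truncation
    in [corner_mx]. *)
Definition ev n k : 'cV[R]_n := \col_i (i == k :> nat)%:R.

Lemma ip_ev n k (u : 'cV[R]_n) (kn : (k < n)%N) :
  ip u (ev n k) = u (Ordinal kn) 0.
Proof.
rewrite ipE (bigD1 (Ordinal kn)) //= big_ord1 mxE eqxx mulr1 big1 ?addr0 // => i.
by rewrite -val_eqE /= => /negPf ik; rewrite big_ord1 mxE ik mulr0.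
Qed.

Lemma orthopair_ev n : (2 <= n)%N -> orthopair (ev n 0) (ev n 1).
Proof.
move=> n2; have n1 : (0 < n)%N by exact: ltn_trans n2.
by split; rewrite /sq ?(ip_ev _ n1) ?(ip_ev _ n2) mxE.
Qed.

End LowDimension.

(** * Transfer to tangent vectors, explicit extremal planes and uniqueness *)

Section Stiefel.
Variable R : realType.
Implicit Types m n p q : nat.

Lemma normF2 m q (M : 'M[R]_(m, q)) : normF M ^+ 2 = sq M.
Proof. by rewrite /normF -sqE sqr_sqrtr ?sq_ge0. Qed.

Lemma seccurv_horizontal n p (A1 A2 : 'M[R]_p) (B1 B2 : 'M[R]_(n - p, p)) :
  seccurv (horizontal A1 B1) (horizontal A2 B2) = curv A1 A2 B1 B2.
Proof. by rewrite /seccurv /Ablock /Bblock !block_mxKul !block_mxKdl !normF2. Qed.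

Lemma dotQ_horizontal n p (A1 A2 : 'M[R]_p) (B1 B2 : 'M[R]_(n - p, p)) :
  dotQ (horizontal A1 B1) (horizontal A2 B2) = 2^-1 * ip A1 A2 + ip B1 B2.
Proof.
rewrite /dotQ -[\tr _]/(ip (hmx A1 B1) (hmx A2 B2)) ip_hmx mulrDr mulrA.
by rewrite mulVf ?mul1r ?pnatr_eq0.
Qed.

Lemma orthonormal_pair_horizontal n p (A1 A2 : 'M[R]_p) (B1 B2 : 'M[R]_(n - p, p)) :
  orthonormal_blocks A1 A2 B1 B2 ->
  orthonormal_pair (horizontal A1 B1) (horizontal A2 B2).
Proof.
move=> [[sk1 sk2] n1 n2 n12]; split; rewrite ?dotQ_horizontal //.
  by apply/tangent_spaceP; exists A1, B1.
by apply/tangent_spaceP; exists A2, B2.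
Qed.

Lemma orthonormal_pairE n p (X Y : 'M[R]_(p + (n - p))) :
  orthonormal_pair X Y -> exists A1 A2 B1 B2,
  [/\ X = horizontal A1 B1, Y = horizontal A2 B2 & orthonormal_blocks A1 A2 B1 B2].
Proof.
move=> [/tangent_spaceP[A1 [B1 [sk1 ->]]] /tangent_spaceP[A2 [B2 [sk2 ->]]]].
by rewrite !dotQ_horizontal => *; exists A1, A2, B1, B2.
Qed.

Lemma seccurv_comm n p (X Y : 'M[R]_(p + (n - p))) : (n - p <= 1)%N ->
  orthonormal_pair X Y -> seccurv X Y = 8^-1 * sq (comm X Y).
Proof.
move=> m1 /orthonormal_pairE [A1 [A2 [B1 [B2 [-> -> [[sk1 sk2] _ _ _]]]]]].
by rewrite seccurv_horizontal curv_small.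
Qed.

Lemma orthonormal_pair_skew n p (X Y : 'M[R]_(p + (n - p))) : (n - p <= 1)%N ->
  X^T = - X -> Y^T = - Y -> sq X = 2 -> sq Y = 2 -> ip X Y = 0 ->
  orthonormal_pair X Y.
Proof.
move=> m1 /(skew_hmx m1) [A1 [B1 [sk1 ->]]] /(skew_hmx m1) [A2 [B2 [sk2 ->]]].
rewrite /sq !ip_hmx -!/(sq _) => n1 n2 n12.
by apply: orthonormal_pair_horizontal; split=> //; lra.
Qed.

Lemma corner_mxE m q (a b c d : R) : corner_mx m q a b c d =
  a *: (ev R m 0 *m (ev R q 0)^T) + b *: (ev R m 0 *m (ev R q 1)^T)
  + c *: (ev R m 1 *m (ev R q 0)^T) + d *: (ev R m 1 *m (ev R q 1)^T).
Proof.
apply/matrixP => i j; rewrite !mxE !big_ord1 !mxE.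
by case: i j => [[|[|i]] ?] [[|[|j]] ?] /=; ring.
Qed.

Lemma orthopairC n (c w : 'cV[R]_n) : orthopair c w -> orthopair w c.
Proof. by move=> [? ? ?]; split; rewrite // ipC. Qed.

Lemma sq_scaled_wedge n (c w : 'cV[R]_n) a b : orthopair c w ->
  a ^+ 2 = 2^-1 -> b ^+ 2 = 2^-1 ->
  sq ((2 * (a * b)) *: (w *m c^T - c *m w^T)) = 2.
Proof.
move=> [c1 w1 cw] a2 b2; rewrite sqZ sq_wedge c1 w1 ipC cw !exprMn a2 b2; lra.
Qed.

(** Prescribing only the squares of [a] and [b] covers all choices of sign. Both [altprod B1 B2] and
    its analogue for the transposes get squared norm 2. *)
Lemma frame_blocks m q (c w : 'cV[R]_m) (d z : 'cV[R]_q) a b :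
  orthopair c w -> orthopair d z -> a ^+ 2 = 2^-1 -> b ^+ 2 = 2^-1 ->
  let B1 := a *: (c *m z^T - w *m d^T) in
  let B2 := b *: (c *m d^T + w *m z^T) in
  orthonormal_blocks 0 0 B1 B2 /\ curv 0 0 B1 B2 = 5 / 4.
Proof.
move=> ocw odz a2 b2 B1 B2; split.
  have [c1 w1 cw] := ocw; have [d1 z1 dz] := odz.
  have [_ _ wc] := orthopairC ocw; have [_ _ zd] := orthopairC odz.
  split; first by rewrite trmx0 oppr0.
  - by rewrite sq0 sqZ a2 sqB !sq_outer ip_outer c1 w1 d1 z1 cw; lra.
  - by rewrite sq0 sqZ b2 /sq !ipL !ip_outer -!/(sq _) c1 w1 d1 z1 cw wc; lra.
  - by rewrite ip0r !ipL !ip_outer -!/(sq _) c1 w1 cw wc dz zd; lra.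
have NE : B1^T *m B2 - B2^T *m B1 = - altprod B1^T B2^T.
  by rewrite /altprod !trmxK opprB.
rewrite /curv /comm !mulmx0 !subrr sq0 sub0r sqN NE sqN.
have -> : B1^T = a *: (z *m c^T - d *m w^T).
  by rewrite linearZ /= linearB /= !trmx_mul !trmxK.
have -> : B2^T = b *: (z *m w^T + d *m c^T).
  by rewrite linearZ /= linearD /= !trmx_mul !trmxK addrC.
rewrite !altprod_frame //; last exact: orthopairC.
rewrite !sq_scaled_wedge //; last exact: orthopairC.
lra.
Qed.

Lemma isqrt2_sqr s : ((-1) ^+ s / Num.sqrt 2) ^+ 2 = 2^-1 :> R.
Proof. by rewrite exprMn sqrr_sign mul1r exprVn sqr_sqrtr ?ler0n. Qed.

Lemma B1maxE m q s : B1max R m q s = ((-1) ^+ s / Num.sqrt 2)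
  *: (ev R m 0 *m (ev R q 1)^T - ev R m 1 *m (ev R q 0)^T).
Proof. by rewrite /B1max corner_mxE !scale0r scale1r scaleN1r add0r addr0. Qed.

Lemma B2maxE m q s : B2max R m q s = ((-1) ^+ s / Num.sqrt 2)
  *: (ev R m 0 *m (ev R q 0)^T + ev R m 1 *m (ev R q 1)^T).
Proof. by rewrite /B2max corner_mxE !scale0r !scale1r !addr0. Qed.

Lemma max_blocks m q s1 s2 : (2 <= m)%N -> (2 <= q)%N ->
  orthonormal_blocks 0 0 (B1max R m q s1) (B2max R m q s2) /\
  curv 0 0 (B1max R m q s1) (B2max R m q s2) = 5 / 4.
Proof.
move=> m2 q2; rewrite B1maxE B2maxE.
by apply: frame_blocks; rewrite ?isqrt2_sqr //; apply: orthopair_ev.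
Qed.

Lemma B1rk1E m q s :
  B1rk1 R m q s = ((-1) ^+ s *: ev R m 1) *m (ev R q 0)^T.
Proof. by rewrite /B1rk1 corner_mxE !scale0r scale1r !add0r addr0 scalemxAl. Qed.

Lemma B2rk1E m q s :
  B2rk1 R m q s = ((-1) ^+ s *: ev R m 0) *m (ev R q 0)^T.
Proof. by rewrite /B2rk1 corner_mxE !scale0r scale1r !addr0 scalemxAl. Qed.

Lemma rank_outer m q (u : 'cV[R]_m) (v : 'cV[R]_q) :
  sq u = 1 -> sq v = 1 -> \rank (u *m v^T) = 1%N.
Proof.
move=> u1 v1; apply/eqP; rewrite eqn_leq mulmx_max_rank lt0n mxrank_eq0.
apply/eqP => /(congr1 (@sq _ _ _)) /eqP; rewrite sq0 sq_outer u1 v1 mulr1.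
by rewrite oner_eq0.
Qed.

(** The blocks have orthonormal left factors and a common right factor, so only the wedge of the
    left factors contributes, with 1/2 * 2. Allowing [q = 1] makes this serve the case [p = 1] as
    well. *)
Lemma rk1_blocks m q s1 s2 : (2 <= m)%N -> (1 <= q)%N ->
  [/\ \rank (B1rk1 R m q s1) = 1%N, \rank (B2rk1 R m q s2) = 1%N,
      orthonormal_blocks 0 0 (B1rk1 R m q s1) (B2rk1 R m q s2) &
      curv 0 0 (B1rk1 R m q s1) (B2rk1 R m q s2) = 1].
Proof.
move=> m2 q1; rewrite B1rk1E B2rk1E.
have [e0 e1 e01] := orthopair_ev R m2.
have f0 : sq (ev R q 0) = 1 by rewrite /sq (ip_ev _ q1) mxE.
have sgn1 s (e : 'cV[R]_m) : sq e = 1 -> sq ((-1) ^+ s *: e) = 1.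
  by move=> he; rewrite sqZ sqrr_sign he mul1r.
have := sgn1 s1 _ e1; have := sgn1 s2 _ e0.
have : ip ((-1) ^+ s1 *: ev R m 1) ((-1) ^+ s2 *: ev R m 0) = 0.
  by rewrite ipZl ipZr ipC e01 !mulr0.
move: (_ *: ev R m 1) (_ *: ev R m 0) (ev R q 0) f0 => u v f f1 uv v1 u1.
split; rewrite ?rank_outer //.
  split; first by rewrite trmx0 oppr0.
  - by rewrite sq0 sq_outer u1 f1; lra.
  - by rewrite sq0 sq_outer v1 f1; lra.
  - by rewrite ip0r ip_outer uv; lra.
have aE : altprod (u *m f^T) (v *m f^T) = v *m u^T - u *m v^T.
  by rewrite /altprod !trmx_mul !trmxK !mulmxA !outer_mul -/(sq f) f1 !scale1r.
have NE : (u *m f^T)^T *m (v *m f^T) - (v *m f^T)^T *m (u *m f^T) = 0.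
  rewrite !trmx_mul !trmxK !mulmxA !outer_mul.
  by rewrite (ipC v) uv !scale0r !mul0mx subrr.
rewrite /curv aE NE /comm !mulmx0 !subrr sq0 sq_wedge u1 v1 ipC uv; lra.
Qed.

Lemma horizontal0Z n p a (B : 'M[R]_(n - p, p)) :
  horizontal 0 (a *: B) = a *: horizontal 0 B.
Proof. by rewrite /horizontal scale_block_mx !scaler0 linearZ scalerN. Qed.

(** The swap reflects that [curv_extremal] presents the first block as the identity type [B2max] and
    the second as the quarter turn [B1max]. *)
Lemma span2_scale_swap (V : vectType R) (x y : V) (a b : R) : a != 0 -> b != 0 ->
  <<[:: a *: y; b *: x]>>%VS = <<[:: x; y]>>%VS.
Proof.
move=> a0 b0; apply/eqP; rewrite eqEsubv; apply/andP.
have mem (z : V) s : z \in s -> z \in <<s>>%VS by exact: memv_span.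
split; apply/span_subvP => z; rewrite !inE => /orP[] /eqP ->.
- by rewrite memvZ // mem // !inE eqxx orbT.
- by rewrite memvZ // mem // !inE eqxx.
- by rewrite -[x in x \in _](scalerK b0) memvZ // mem // !inE eqxx orbT.
- by rewrite -[y in y \in _](scalerK a0) memvZ // mem // !inE eqxx.
Qed.

(** [U] and [V] carry the orthonormal pairs of [curv_extremal] to the first two standard basis
    vectors. The remaining signs do not change the span, so every choice of [s1] and [s2] gives the
    same plane. *)
Lemma max_plane_unique n p (X Y : 'M[R]_(p + (n - p))) s1 s2 :
  (2 <= p)%N -> (p + 2 <= n)%N ->
  orthonormal_pair X Y -> seccurv X Y = 5 / 4 ->
  [/\ Ablock X = 0, Ablock Y = 0 &
    exists (U : 'M[R]_(n - p)) (V : 'M[R]_p),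
      [/\ orthogonal_mx U, orthogonal_mx V &
        <<[:: horizontal 0 (U^T *m Bblock X *m V);
              horizontal 0 (U^T *m Bblock Y *m V)]>>%VS
        = <<[:: horizontal 0 (B1max R (n - p) p s1);
                horizontal 0 (B2max R (n - p) p s2)]>>%VS]].
Proof.
move=> p2 pn /orthonormal_pairE [A1 [A2 [B1 [B2 [-> -> on]]]]].
rewrite seccurv_horizontal /Ablock /Bblock !block_mxKul !block_mxKdl.
move=> /(curv_extremal on) [-> -> [c [w [d [z [ocw odz -> ->]]]]]]; split=> //.
have m2 : (2 <= n - p)%N by rewrite leq_subRL // (leq_trans (leq_addr _ _) pn).
have [e0 e1 e01] := orthopair_ev R m2; have [f0 f1 f01] := orthopair_ev R p2.
have [c1 w1 cw] := ocw; have [d1 z1 dz] := odz.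
have [||| U [UU Uc Uw]] :=
  @orthogonal_move2 R _ c w (ev R (n - p) 0) (ev R (n - p) 1).
- by rewrite c1 e0.
- by rewrite w1 e1.
- by rewrite cw e01.
have [||| V [VV Vd Vz]] := @orthogonal_move2 R _ d z (ev R p 0) (ev R p 1).
- by rewrite d1 f0.
- by rewrite z1 f1.
- by rewrite dz f01.
exists U, V; split=> //.
have conjE (x : 'cV[R]_(n - p)) (y : 'cV[R]_p) :
    U^T *m (x *m y^T) *m V = (U^T *m x) *m (V^T *m y)^T.
  by rewrite trmx_mul trmxK !mulmxA.
pose r : R := (Num.sqrt 2)^-1; pose sg (s : bool) : R := (-1) ^+ s.
have sgsg s : sg s * sg s = 1 by rewrite -expr2 sqrr_sign.
have -> : U^T *m (r *: (c *m d^T + w *m z^T)) *m V = sg s2 *: B2max R (n - p) p s2.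
  rewrite -scalemxAr -scalemxAl mulmxDr mulmxDl !conjE Uc Uw Vd Vz.
  by rewrite B2maxE scalerA mulrA sgsg mul1r.
have -> : U^T *m (r *: (w *m d^T - c *m z^T)) *m V = - sg s1 *: B1max R (n - p) p s1.
  rewrite -scalemxAr -scalemxAl mulmxBr mulmxBl !conjE Uc Uw Vd Vz.
  by rewrite B1maxE scalerA mulrA mulNr sgsg mulN1r scaleNr -scalerN opprB.
rewrite !horizontal0Z span2_scale_swap // ?oppr_eq0 signr_eq0 //.
Qed.

End Stiefel.

Theorem theorem3p6 (R : realType) (n p : nat)
  (p_ge1 : (1 <= p)%N) (p_le_n : (p <= n)%N) (dim_ge2 : (2 <= dimSt R n p)%N) :
  (forall X Y : 'M[R]_(p + (n - p)), orthonormal_pair X Y ->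
     0 <= seccurv X Y <= 5 / 4)
  /\
  ((2 <= p)%N -> (p + 2 <= n)%N -> forall s1 s2 : bool,
     let X0 := horizontal 0 (B1max R (n - p) p s1) in
     let Y0 := horizontal 0 (B2max R (n - p) p s2) in
     (orthonormal_pair X0 Y0 /\ seccurv X0 Y0 = 5 / 4)
     /\ forall X Y : 'M[R]_(p + (n - p)),
          orthonormal_pair X Y -> seccurv X Y = 5 / 4 ->
          [/\ Ablock X = 0, Ablock Y = 0 &
              exists (U : 'M[R]_(n - p)) (V : 'M[R]_p),
                [/\ orthogonal_mx U, orthogonal_mx V &
                    <<[:: horizontal 0 (U^T *m Bblock X *m V);
                          horizontal 0 (U^T *m Bblock Y *m V)]>>%VS
                    = <<[:: X0; Y0]>>%VS]])
  /\
  ((forall X Y : 'M[R]_(p + (n - p)), orthonormal_pair X Y ->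
      \rank (Bblock X) = 1%N \/ \rank (Bblock Y) = 1%N ->
      seccurv X Y <= 1)
   /\
   ((2 <= p)%N -> (p + 2 <= n)%N -> forall s1 s2 : bool,
      let B1 := B1rk1 R (n - p) p s1 in
      let B2 := B2rk1 R (n - p) p s2 in
      [/\ \rank B1 = 1%N, \rank B2 = 1%N,
          orthonormal_pair (horizontal 0 B1) (horizontal 0 B2) &
          seccurv (horizontal 0 B1) (horizontal 0 B2) = 1]))
  /\
  (p = 1%N -> (3 <= n)%N ->
     (forall X Y : 'M[R]_(p + (n - p)), orthonormal_pair X Y ->
        seccurv X Y <= 1)
     /\ forall s1 s2 : bool,
          let X0 := horizontal 0 (B1rk1 R (n - p) p s1) in
          let Y0 := horizontal 0 (B2rk1 R (n - p) p s2) in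
          orthonormal_pair X0 Y0 /\ seccurv X0 Y0 = 1)
  /\
  ((n, p) = (3, 2)%N \/ (n, p) = (3, 3)%N ->
     forall X Y : 'M[R]_(p + (n - p)), orthonormal_pair X Y ->
       seccurv X Y = 1 / 4)
  /\
  ((4 <= n)%N -> p = (n - 1)%N \/ p = n ->
     (forall X Y : 'M[R]_(p + (n - p)), orthonormal_pair X Y ->
        seccurv X Y <= 1 / 2)
     /\ exists X Y : 'M[R]_(p + (n - p)),
          orthonormal_pair X Y /\ seccurv X Y = 1 / 2).
Proof.
have item0 : forall X Y : 'M[R]_(p + (n - p)), orthonormal_pair X Y ->
    0 <= seccurv X Y <= 5 / 4.
  move=> X Y /orthonormal_pairE [A1 [A2 [B1 [B2 [-> -> on]]]]].
  by rewrite seccurv_horizontal curv_ge0 curv_le54.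
have item2 : forall X Y : 'M[R]_(p + (n - p)), orthonormal_pair X Y ->
    \rank (Bblock X) = 1%N \/ \rank (Bblock Y) = 1%N -> seccurv X Y <= 1.
  move=> X Y /orthonormal_pairE [A1 [A2 [B1 [B2 [-> -> on]]]]].
  rewrite seccurv_horizontal /Bblock !block_mxKdl => -[rk|rk].
    exact: curv_rank1.
  have [[sk1 sk2] n1 n2 n12] := on; rewrite -curvC.
  by apply: curv_rank1 rk; split=> //; rewrite (ipC A2) (ipC B2).
split=> //; split; [|split; [|split; [|split]]].
- move=> p2 pn s1 s2 X0 Y0.
  have m2 : (2 <= n - p)%N by rewrite leq_subRL // (leq_trans (leq_addr _ _) pn).
  split; last by move=> X Y on K; exact: max_plane_unique.
  have [on K] := max_blocks R s1 s2 m2 p2.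
  by rewrite seccurv_horizontal; split=> //; exact: orthonormal_pair_horizontal.
- split=> // p2 pn s1 s2 B1 B2.
  have m2 : (2 <= n - p)%N by rewrite leq_subRL // (leq_trans (leq_addr _ _) pn).
  have [r1 r2 on K] := rk1_blocks R s1 s2 m2 p_ge1.
  by rewrite seccurv_horizontal; split=> //; exact: orthonormal_pair_horizontal.
- move=> p1 n3; subst p; split.
    (* For [p = 1] the block [A1] is skew of size 1, hence zero; then |B1| = 1 and the single column
       [B1] has rank 1. *)
    move=> X Y on; apply: item2 => //; left; move: on.
    move=> /orthonormal_pairE [A1 [A2 [B1 [B2 [-> _ [[sk1 _] n1 _ _]]]]]].
    rewrite /Bblock block_mxKdl; apply/eqP; rewrite eqn_leq.
    rewrite rank_leq_col lt0n mxrank_eq0; apply: contra_eqN n1 => /eqP ->.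
    have -> : A1 = 0.
      have [//|a ->] := skew_small _ sk1.
      by apply/matrixP => i j; rewrite !ord1 !mxE subrr mulr0.
    by rewrite !sq0 mulr0 addr0 eq_sym oner_eq0.
  move=> s1 s2 X0 Y0.
  have m2 : (2 <= n - 1)%N by rewrite leq_subRL.
  have [r1 r2 on K] := rk1_blocks R s1 s2 m2 p_ge1.
  by rewrite seccurv_horizontal; split=> //; exact: orthonormal_pair_horizontal.
- move=> np X Y on.
  have m1 : (n - p <= 1)%N by case: np => -[-> ->].
  rewrite (seccurv_comm m1 on).
  have [A1 [A2 [B1 [B2 [EX EY [[sk1 sk2] n1 n2 n12]]]]]] := orthonormal_pairE on.
  have skX : X^T = - X by rewrite EX; exact: hmx_skew.
  have skY : Y^T = - Y by rewrite EY; exact: hmx_skew.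
  have nX : sq X = 2 by rewrite EX /sq ip_hmx -!/(sq _); lra.
  have nY : sq Y = 2 by rewrite EY /sq ip_hmx -!/(sq _); lra.
  have nXY : ip X Y = 0 by rewrite EX EY ip_hmx; lra.
  have N3 : (p + (n - p) = 3)%N by case: np => -[-> ->].
  move: X Y skX skY nX nY nXY {EX EY on}; rewrite N3 => X Y skX skY nX nY nXY.
  (* 2 |[X,Y]|^2 = 2 * 2 - 0, so the curvature is 2/8. *)
  by have := sq_comm_skew3 skX skY; rewrite nX nY nXY; lra.
move=> n4 np.
have m1 : (n - p <= 1)%N.
  by case: np => ->; rewrite ?subnn // subKn // (leq_trans _ n4).
split.
  move=> X Y /orthonormal_pairE [A1 [A2 [B1 [B2 [-> -> on]]]]].
  by rewrite seccurv_horizontal curv_small_le12.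
have N4 : (4 <= p + (n - p))%N by rewrite subnKC.
(* Since [n - p <= 1], any orthonormal skew pair is a pair of tangent vectors; this one has
   |[X,Y]|^2 = 4 and curvature 4/8. *)
have [X [Y [[skX skY] nX nY nXY c4]]] := orthonormal_so4 R N4.
have on := orthonormal_pair_skew m1 skX skY nX nY nXY.
by exists X, Y; split=> //; rewrite (seccurv_comm m1 on) c4; lra.
Qed.
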